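(* There is a real sequence $(\varepsilon_N)_{N\ge 1}$ with $\varepsilon_N=O(1/N)$ as $N\to\infty$ such that, for every integer $N\ge 1$, the cosine measure of the set $D_3\subset\mathbb{R}^N$ satisfies $$\mathrm{cm}(D_3)\ \ge\ \frac{1}{\sqrt{\ln(N)+\gamma+\varepsilon_N}}\ \ge\ \frac{1}{\sqrt{\ln(N)+1}},$$ where $\gamma$ is the Euler–Mascheroni constant (in particular $\ln(N)+\gamma+\varepsilon_N>0$ for every $N\ge 1$).
   Context: For a finite set $D\subset\mathbb{R}^N$ that positively spans $\mathbb{R}^N$ (every vector of $\mathbb{R}^N$ is a linear combination of elements of $D$ with nonnegative coefficients), the cosine measure is $$\mathrm{cm}(D)=\min_{0\neq v\in\mathbb{R}^N}\ \max_{0\neq d\in D}\ \frac{v^T d}{\|v\|_2\,\|d\|_2}.$$ The set $D_3$ is $$D_3=\Big\{d^{(k)}\in\mathbb{R}^N \ :\ d^{(k)}_l=[\mathrm{radix}_3(k)]_l-1,\ 1\le l\le N,\ 0\le k\le 3^N-1\Big\},$$ where $\mathrm{radix}_3(k)\in\{0,1,2\}^N$ is the vector of the $N$ base-3 digits of the integer $k$ and $[\mathrm{radix}_3(k)]_l$ its $l$-th component. Equivalently, $D_3=\{-1,0,1\}^N$ (the zero vector is excluded from the maximum in the cosine measure). *)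

(* Defs.v *)
From HB Require Import structures.
From mathcomp Require Import all_boot all_order all_algebra.
From mathcomp Require Import all_classical all_reals all_analysis.

Set Implicit Arguments.
Unset Strict Implicit.
Unset Printing Implicit Defensive.

Import Order.TTheory GRing.Theory Num.Theory.
Import numFieldNormedType.Exports.

Local Open Scope classical_set_scope.
Local Open Scope ring_scope.

(* The norm `|v| that the library puts on matrices is the sup norm. *)
Definition norm_2 (R : realType) (N : nat) (v : 'cV[R]_N) : R :=
  Num.sqrt (\sum_(i < N) v i 0 ^+ 2).

Definition cosine (R : realType) (N : nat) (v d : 'cV[R]_N) : R :=
  (v^T *m d) 0 0 / (norm_2 v * norm_2 d).

(* The cosine measure  min_{v != 0} max_{d in D, d != 0} cosine v d  of a     *)
(* finite positively spanning set D of R^N with N >= 1.  For such D the sup   *)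
(* is over a finite nonempty set, hence is a maximum.  It is a continuous     *)
(* function of v that is invariant under positive scaling, so the inf is      *)
(* attained on the Euclidean unit sphere and is a minimum.                    *)
Definition cosine_measure (R : realType) (N : nat) (D : set 'cV[R]_N) : R :=
  inf [set sup [set cosine v d | d in [set d | D d /\ d != 0]]
      | v in [set v : 'cV[R]_N | v != 0]].

(* Digits are indexed from 0, least significant first. *)
Definition radix3 (N k : nat) (l : 'I_N) : nat := ((k %/ 3 ^ l) %% 3)%N.

Definition d3 (R : realType) (N k : nat) : 'cV[R]_N :=
  \col_(l < N) ((radix3 k l)%:R - 1).

Definition D3 (R : realType) (N : nat) : set 'cV[R]_N :=
  [set d3 R N k | k in [set k | (k <= 3 ^ N - 1)%N]].
Arguments D3 : clear implicits.

(* series harmonic n = 1 + 1/2 + ... + 1/n *)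
Definition euler_gamma (R : realType) : R :=
  limn (fun n : nat => series harmonic n - ln (n%:R : R)).

(* Main.v *)
(* Take eps_N = H_N - ln N - gamma with H_N the N-th harmonic number, so that  *)
(* the bound reads cm(D3) >= 1 / sqrt H_N.  For v != 0 let m_i be the number   *)
(* of j with |v_j| >= |v_i|.  The sign pattern of v on these m_i coordinates   *)
(* lies in D3 and has cosine at least |v_i| sqrt(m_i) / ||v|| with v.  If i    *)
(* maximises v_i^2 m_i, then                                                   *)
(*   ||v||^2 <= v_i^2 m_i * (\sum_j 1 / m_j) <= v_i^2 m_i * H_N,               *)
(* and this cosine is at least 1 / sqrt H_N.                                   *)
Require Import Defs.
From mathcomp Require Import all_boot all_order all_algebra.
From mathcomp Require Import all_classical all_reals all_analysis.
From mathcomp Require Import ring lra zify.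
Import Order.TTheory GRing.Theory Num.Theory.
Import numFieldNormedType.Exports.
Local Open Scope classical_set_scope.
Local Open Scope ring_scope.

(** With [eps] chosen so that the radicand is the harmonic number H_N, the claim splits in two.
    Geometrically, every nonzero v has a thresholded sign pattern of cosine at least 1/sqrt H_N
    ([exists_D3_cosine_ge]). The threshold is found by averaging, since reciprocal ranks sum to at
    most H_N ([sum_inv_rank_le]). Analytically, 1/(n+1) <= ln(n+1) - ln n <= 1/n gives 0 <= eps_N <=
    1/N ([harmonic_ln_bounds]) and H_N <= ln N + 1 ([harmonic_le_ln]). *)

Lemma ln_incr_bounds (R : realType) (n : nat) :
  n.+2%:R^-1 <= ln (n.+2%:R : R) - ln n.+1%:R <= n.+1%:R^-1.
Proof.
have -> : n.+2%:R = n.+1%:R + 1 :> R by rewrite natr1.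
have : 0 < n.+1%:R :> R by rewrite ltr0n.
move: n.+1%:R => x x0; have x1 : 0 < x + 1 by lra.
have e1 : x / (x + 1) = 1 + - (x + 1)^-1 by field; rewrite lt0r_neq0.
have e2 : (x + 1) / x = 1 + x^-1 by field; rewrite lt0r_neq0.
apply/andP; split; last first.
  rewrite -ln_div ?posrE// e2 le_ln1Dx//.
  by rewrite (lt_trans _ (_ : 0 < _)) ?ltrN10 ?invr_gt0.
rewrite -opprB lerNr -ln_div ?posrE// e1 le_ln1Dx//.
by rewrite ltrN2 invf_lt1//; lra.
Qed.

(** H_n - ln n decreases and H_n - ln n - 1/n increases, so the common limit gamma lies between
    them. *)
Lemma harmonic_ln_bounds (R : realType) (n : nat) :
  euler_gamma R <= series harmonic n.+1 - ln n.+1%:R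
                <= euler_gamma R + n.+1%:R^-1.
Proof.
pose w m : R := series harmonic m.+1 - ln m.+1%:R.
have Sw m : series harmonic m.+2 = series harmonic m.+1 + m.+2%:R^-1 :> R.
  by rewrite /series /= big_nat_recr.
have w_dec : {homo w : n m / (n <= m)%N >-> m <= n}.
  apply/nonincreasing_seqP => m; have /andP[+ _] := ln_incr_bounds R m.
  rewrite /w Sw; move: (series _ _) (ln m.+2%:R) (ln m.+1%:R) => h a b.
  by move: _^-1 => c; lra.
have z_inc : {homo (fun m => w m - m.+1%:R^-1) : n m / (n <= m)%N >-> n <= m}.
  apply/nondecreasing_seqP => m; have /andP[_] := ln_incr_bounds R m.
  rewrite /w Sw; move: (series _ _) (ln m.+2%:R) (ln m.+1%:R) => h a b.
  by move: m.+1%:R^-1 m.+2%:R^-1 => c d; lra.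
have w_cvg : cvgn w.
  (* The increasing sequence starts at H_1 - ln 1 - 1 = 0, whence [w] is nonnegative. *)
  apply: nonincreasing_is_cvgn => //; exists 0 => _ [m _ <-].
  have /= := z_inc 0%N m (leq0n m).
  have : 0 <= m.+1%:R^-1 :> R by rewrite invr_ge0.
  rewrite {1}/w /series /= big_nat1 /= ln1 invr1 subr0 subrr.
  by move: (w m) m.+1%:R^-1 => a b; lra.
have -> : euler_gamma R = limn w.
  apply: cvg_lim => //; rewrite -cvg_shiftS; exact: w_cvg.
apply/andP; split; first exact: nonincreasing_cvgn_ge.
rewrite -lerBlDr; apply: limr_ge => //.
exists n => // m /= nm.
have /= := z_inc _ _ nm; have : 0 <= m.+1%:R^-1 :> R by rewrite invr_ge0.
rewrite -/(w n); move: (w n) (w m) n.+1%:R^-1 m.+1%:R^-1 => a b c d.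
by lra.
Qed.

(** Remove a minimiser of [f]: its count is all of [#|A|], which gives the last harmonic term, and
    the removal only lowers the other counts. Ties make the sum smaller. *)
Lemma sum_inv_rank_le (R : realType) (I : finType) (f : I -> R) (A : {set I}) :
  \sum_(i in A) (#|[pred j in A | f i <= f j]|%:R)^-1
    <= series harmonic #|A| :> R.
Proof.
move: {2}#|A| (erefl #|A|) => n; elim: n A => [|n IH] A cA.
  by rewrite (cards0_eq cA) big_set0 cards0 /series /= big_geq.
have /set0Pn[i0 i0A] : A != finset.set0 by rewrite -card_gt0 cA.
case: (arg_minP f i0A) => m mA m_min.
have {}mA : m \in A := mA.
have cB : #|A :\ m| = n by move: cA; rewrite (cardsD1 m) mA => -[].
rewrite (bigD1 m mA) /= cA /series /= big_nat_recr //= addrC lerD //.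
  rewrite -cB (le_trans _ (IH _ cB)) //.
  rewrite (eq_bigl (fun i => i \in A :\ m)); last first.
    by move=> i; rewrite !inE andbC.
  apply: ler_sum => i iB; rewrite lef_pV2 ?posrE ?ltr0n ?ler_nat.
  - apply/subset_leq_card/fintype.subsetP => j.
    by rewrite !inE => /andP[/andP[_ ->] ->].
  - move: iB; rewrite inE => /andP[_ iA]; apply/card_gt0P; exists i.
    by rewrite inE iA lexx.
  - by apply/card_gt0P; exists i; rewrite inE iB lexx.
rewrite (@eq_card _ _ (mem A)) ?cA// => j; rewrite inE.
by case jA : (j \in A) => //=; exact: m_min.
Qed.

(** Digits are given on all of [nat] so that the induction can strip the lowest one by a shift. *)
Lemma radix3_surj (N : nat) (t : nat -> nat) (tlt3 : forall l, (t l < 3)%N) :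
  exists2 k, (k < 3 ^ N)%N & forall l : 'I_N, radix3 k l = t l.
Proof.
elim: N t tlt3 => [|N IH] t tlt3; first by exists 0%N => // -[].
have [k k_lt kE] := IH (fun l => t l.+1) (fun l => tlt3 l.+1).
exists (t 0%N + k * 3)%N; first by rewrite expnSr; have := tlt3 0%N; lia.
case=> -[|l] lN; rewrite /radix3 /=.
  by rewrite expn0 divn1 addnC modnMDl modn_small.
rewrite expnS divnMA divnDMl // (divn_small (tlt3 0%N)) add0n.
exact: (kE (Ordinal (lN : (l < N)%N))).
Qed.

Lemma D3_sign (R : realType) (N : nat) (d : 'cV[R]_N)
    (d_sign : forall l, d l 0 \in [:: -1; 0; 1]) : D3 R N d.
Proof.
pose digit (x : R) : nat := if x == 1 then 2 else if x == 0 then 1 else 0.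
pose t l := if insub l is Some i then digit (d i 0) else 0%N.
have tlt3 l : (t l < 3)%N.
  by rewrite /t /digit; case: (insub l) => // i; do 2?case: ifP.
have [k k_lt kE] := @radix3_surj N t tlt3.
exists k => /=; first by rewrite -ltnS subn1 prednK ?expn_gt0.
apply/matrixP => l j; rewrite ord1 mxE kE /t valK /digit.
move: (d_sign l); rewrite !inE => /or3P[] /eqP ->.
- by rewrite !lt_eqF ?ltrN10 ?(lt_trans (ltrN10 R)) // sub0r.
- by rewrite eq_sym oner_eq0 eqxx subrr.
- by rewrite eqxx; lra.
Qed.

Lemma cosine_measure_D3_ge (R : realType) (N : nat) (c : R) :
  (0 < N)%N ->
  (forall v : 'cV[R]_N, v != 0 ->
     exists d, [/\ D3 R N d, d != 0 & c <= cosine v d]) ->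
  c <= cosine_measure (D3 R N).
Proof.
move=> N0 cP; apply: lb_le_inf.
  (* The infimum is over a nonempty set: the all-ones vector is nonzero because N > 0. *)
  exists (sup [set cosine (const_mx 1) d | d in [set d | D3 R N d /\ d != 0]]).
  exists (const_mx 1) => //=; apply/eqP => /matrixP /(_ (Ordinal N0) 0).
  by rewrite !mxE => /eqP; rewrite oner_eq0.
move=> _ [v /= v0 <-]; have [d [dD d0 cd]] := cP v v0.
apply: (le_trans cd); apply: ub_le_sup; last by exists d.
(* A crude upper bound, needed only for the supremum to be a genuine one. *)
exists (\sum_(k < 3 ^ N) `|cosine v (d3 R N k)|) => _ [_ [[k /= kN <-] _] <-].
have kN' : (k < 3 ^ N)%N.
  by rewrite -(prednK (_ : 0 < 3 ^ N)%N) ?expn_gt0 // ltnS -subn1.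
rewrite (bigD1 (Ordinal kN')) //= (le_trans (ler_norm _)) // lerDl.
exact: sumr_ge0.
Qed.

Lemma exists_D3_cosine_ge (R : realType) (N : nat) (v : 'cV[R]_N) :
  v != 0 ->
  exists d, [/\ D3 R N d, d != 0 &
                1 / Num.sqrt (series harmonic N) <= cosine v d].
Proof.
move=> v0; have [i0 vi0] : exists i, v i 0 != 0.
  apply/existsP; apply: contraNT v0; rewrite negb_exists => /forallP v0.
  apply/eqP/matrixP => i j; rewrite ord1 mxE; apply/eqP.
  by rewrite -[_ == _]negbK v0.
pose m i := #|[pred j in [set: 'I_N]%SET | `|v i 0| <= `|v j 0|]|.
have m0 i : 0 < (m i)%:R :> R.
  by rewrite ltr0n; apply/card_gt0P; exists i; rewrite !inE /=.
pose H : R := series harmonic N.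
have mH : \sum_i (m i)%:R^-1 <= H.
  have := @sum_inv_rank_le R _ (fun i => `|v i 0|) [set: 'I_N]%SET.
  by rewrite cardsT card_ord; under eq_bigl do rewrite inE.
have [i _ i_max] :=
  @arg_maxP _ R _ i0 predT (fun i => v i 0 ^+ 2 * (m i)%:R) isT.
pose S := \sum_i v i 0 ^+ 2.
have S0 : 0 < S.
  rewrite /S (bigD1 i0) //= ltr_wpDr ?sumr_ge0 // => [j _|].
    exact: sqr_ge0.
  by rewrite lt0r sqrf_eq0 vi0 sqr_ge0.
(* Maximality of [i] gives v_j^2 <= v_i^2 m_i / m_j; sum over j. *)
have SH : S <= v i 0 ^+ 2 * (m i)%:R * H.
  rewrite (@le_trans _ _ (v i 0 ^+ 2 * (m i)%:R * \sum_j (m j)%:R^-1)) //.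
    rewrite mulr_sumr; apply: ler_sum => j _.
    by rewrite ler_pdivlMr //; exact: i_max.
  by rewrite ler_wpM2l // mulr_ge0 ?sqr_ge0 // ltW.
have vi : v i 0 != 0.
  by apply: contraTneq SH => ->; rewrite expr0n !mul0r -ltNge.
have H0 : 0 < H.
  rewrite (lt_le_trans _ mH) // (bigD1 i) //= ltr_wpDr ?invr_gt0 //.
  by apply: sumr_ge0 => j _; rewrite invr_ge0 ltW.
pose d : 'cV[R]_N :=
  \col_j (if `|v i 0| <= `|v j 0| then Num.sg (v j 0) else 0).
(* Kept entries satisfy |v_j| >= |v_i| > 0, so each sign squares to 1. *)
have normd : norm_2 d = Num.sqrt (m i)%:R.
  congr Num.sqrt; rewrite /m -sum1_card natr_sum [RHS]big_mkcond.
  apply: eq_bigr => j _; rewrite mxE !inE /=; case: ifPn => [vij|]; last first.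
    by rewrite expr0n.
  by rewrite sqr_sg -normr_gt0 (lt_le_trans _ vij) ?normr_gt0.
exists d; split.
- apply: D3_sign => l; rewrite mxE; case: ifP => _; last first.
    by rewrite !inE eqxx orbT.
  by rewrite !inE; case: sgrP; rewrite eqxx ?orbT.
- apply/eqP => d0; move: normd; rewrite d0 /norm_2 big1 => [|j _]; last first.
    by rewrite mxE expr0n.
  by move=> /eqP; rewrite sqrtr0 eq_sym sqrtr_eq0 leNgt m0.
have dot : `|v i 0| * (m i)%:R <= (v^T *m d) 0 0.
  rewrite mxE /m -sum1_card natr_sum mulr_sumr big_mkcond.
  apply: ler_sum => j _; rewrite !mxE !inE /=; case: ifP => vij.
    by rewrite mulr1 mulrC -normrEsg.
  by rewrite mulr0.
rewrite /cosine normd /norm_2 -/S -/H ler_pdivlMr ?mulr_gt0 ?sqrtr_gt0 //.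
(* Writing m_i as a square cancels one factor sqrt m_i against [norm_2 d]; what remains is the
   square root of [SH]. *)
rewrite (le_trans _ dot) // -[in X in _ <= X](sqr_sqrtr (ltW (m0 i))) expr2.
rewrite mul1r mulrA mulrA ler_wpM2r ?sqrtr_ge0 // mulrC.
rewrite ler_pdivrMr ?sqrtr_gt0 //.
have vm0 : 0 <= v i 0 ^+ 2 * (m i)%:R by rewrite mulr_ge0 ?sqr_ge0 // ltW.
by rewrite -sqrtr_sqr -sqrtrM ?sqr_ge0 // -sqrtrM // ler_wsqrtr.
Qed.

(** Equality holds at N = 1, and afterwards ln grows at least as fast as H_N. *)
Lemma harmonic_le_ln (R : realType) (n : nat) :
  series harmonic n.+1 <= ln n.+1%:R + 1 :> R.
Proof.
elim: n => [|n IH]; first by rewrite /series /= big_nat1 invr1 ln1 add0r.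
rewrite seriesSr /=; have /andP[+ _] := ln_incr_bounds R n; move: IH.
move: (series _ _) (ln n.+2%:R) (ln n.+1%:R) n.+2%:R^-1 => h a b c.
by lra.
Qed.

Theorem theorem4 (R : realType) :
  exists eps : nat -> R,
    eps =O_\oo (fun N : nat => N%:R^-1 : R) /\
    forall N : nat, (1 <= N)%N ->
      [/\ 0 < ln N%:R + euler_gamma R + eps N,
          cosine_measure (D3 R N)
            >= 1 / Num.sqrt (ln N%:R + euler_gamma R + eps N)
        & 1 / Num.sqrt (ln N%:R + euler_gamma R + eps N)
            >= 1 / Num.sqrt (ln N%:R + 1)].
Proof.
exists (fun N => series harmonic N - ln N%:R - euler_gamma R); split.
  apply/eqO_exP; exists 1 => //; exists 1%N => // -[|n] // _ /=.
  have /andP[lo hi] := harmonic_ln_bounds R n.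
  by rewrite mul1r !ger0_norm ?invr_ge0 // ?subr_ge0 // lerBlDl.
case=> // n _; rewrite -addrA subrKC addrC subrK.
have H0 : 0 < series harmonic n.+1 :> R.
  rewrite seriesSr ltr_wpDl ?harmonic_gt0 //.
  by apply: sumr_ge0 => k _; exact: harmonic_ge0.
split=> //.
  by apply: cosine_measure_D3_ge => // v; exact: exists_D3_cosine_ge.
have ln_ge := harmonic_le_ln R n.
rewrite !div1r lef_pV2 ?posrE ?sqrtr_gt0 ?(lt_le_trans H0) //.
exact: ler_wsqrtr.
Qed.
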